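(* Fix $k\geq 1$. For $n\geq 1$ let $u,v$ be chosen independently and uniformly at random from $\Sigma_k^n$. Then the expected value of $\operatorname{lso}(u,v)$ is $O(1)$, i.e., bounded by a constant independent of $n$.
   Context: $\Sigma_k=\{0,1,\ldots,k-1\}$ and $\Sigma_k^n$ is the set of length-$n$ words over $\Sigma_k$. A right-border of a pair $(u,v)$ is a non-empty word that is a proper suffix of $u$ and a proper prefix of $v$. $\operatorname{lso}(u,v)$ is the length of the shortest right-border of $(u,v)$, and $\operatorname{lso}(u,v)=0$ if $(u,v)$ has no right-border. *)

(* Defs.v *)
From mathcomp Require Import all_boot all_order all_algebra.
From mathcomp Require Import reals.

Set Implicit Arguments.
Unset Strict Implicit.
Unset Printing Implicit Defensive.

Import Order.TTheory GRing.Theory Num.Theory.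

Section Words.
Variable A : finType.
Implicit Types u v w : seq A.

Definition proper_suffix w u : bool := suffix w u && (w != u).
Definition proper_prefix w v : bool := prefix w v && (w != v).

Definition right_border u v w : bool :=
  [&& w != [::], proper_suffix w u & proper_prefix w v].

Definition right_border_length u v (l : nat) : bool :=
  [exists w : l.-tuple A, right_border u v w].

(* The list below enumerates the lengths of right-borders in increasing order
   (none exceeds size u), so its head is the smallest; see the two lemmas. *)
Definition lso u v : nat :=
  head 0 [seq l <- iota 0 (size u).+1 | right_border_length u v l].

Lemma right_border_lengthP u v l :
  reflect (exists2 w, right_border u v w & size w = l)
          (right_border_length u v l).
Proof.
apply: (iffP existsP) => [[w Hw]|[w Hw <-]].
  by exists w => //; rewrite size_tuple.
by exists (in_tuple w).
Qed.

Lemma lso_none u v : (forall w, ~~ right_border u v w) -> lso u v = 0.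
Proof.
move=> H; rewrite /lso (@eq_filter _ _ pred0) ?filter_pred0 // => l.
by apply/right_border_lengthP => -[w]; rewrite (negPf (H w)).
Qed.

Lemma lso_shortest u v w0 : right_border u v w0 ->
  (exists2 w, right_border u v w & size w = lso u v) /\
  (forall w, right_border u v w -> lso u v <= size w).
Proof.
have mem w : right_border u v w ->
    size w \in [seq l <- iota 0 (size u).+1 | right_border_length u v l].
  move=> Hw; rewrite mem_filter mem_iota add0n ltnS /=; apply/andP; split.
    by apply/right_border_lengthP; exists w.
  by case/and3P: Hw => _ /andP[/size_suffix].
move=> /mem Hw0.
have srt : sorted leq [seq l <- iota 0 (size u).+1 | right_border_length u v l].
  by apply: sorted_filter; [exact: leq_trans | exact: iota_sorted].
split=> [|w /mem]; rewrite /lso; last first.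
  case: (filter _ _) srt => //= l s Hs; rewrite inE => /predU1P[-> //|].
  by move: Hs; rewrite (path_sortedE leq_trans) => /andP[/allP Hs _] /Hs.
have hd : head 0 [seq l <- iota 0 (size u).+1 | right_border_length u v l]
    \in [seq l <- iota 0 (size u).+1 | right_border_length u v l].
  by case: (filter _ _) Hw0 => //= l s _; rewrite mem_head.
by move: hd; rewrite mem_filter => /andP[/right_border_lengthP].
Qed.

End Words.

Local Open Scope ring_scope.

Definition uniform_prob (R : realType) (T : finType) (x : T) : R :=
  (#|T|%:R)^-1.

(* Independence is the product form of the joint law of (u, v). *)
Definition expected_lso (R : realType) (k n : nat) : R :=
  \sum_(u : n.-tuple 'I_k) \sum_(v : n.-tuple 'I_k)
    uniform_prob R u * uniform_prob R v * (lso u v)%:R.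

(* Main.v *)
Require Import Defs.
From mathcomp Require Import all_boot all_order all_algebra.
From mathcomp Require Import reals.
From mathcomp Require Import zify.

Set Implicit Arguments.
Unset Strict Implicit.
Unset Printing Implicit Defensive.

(** For each fixed [u], at most [k ^ (n - l)] of the words [v] share with [u]
    a right-border of length [l].  Hence, when [k >= 2], the values
    [lso u v] sum over [v] to at most [\sum_(l < n) l * k ^ (n - l)], which is
    at most [2 * k ^ n].  When [k = 1] this series is unbounded, but then the
    shortest right-border has length at most one.  The expectation is at most
    [2] in both cases. *)

Section RightBorders.
Variable A : finType.
Implicit Types u v w : seq A.

Lemma lso_exists u v :
  lso u v != 0 -> exists2 w, right_border u v w & size w = lso u v.
Proof.
(* No border is longer than [u], so a search over the lengths up to [size u] decides whether one
   exists. *)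
move=> lso_neq0; case: (boolP [exists l : 'I_(size u).+1,
    right_border_length u v l]) => [/existsP[l]|noborder].
  by case/right_border_lengthP=> w /lso_shortest[].
case/eqP: lso_neq0; apply: lso_none => w; apply: contra noborder => bw.
have ltw : size w < (size u).+1.
  by case/and3P: bw => _ /andP[/size_suffix].
by apply/existsP; exists (Ordinal ltw); apply/right_border_lengthP; exists w.
Qed.

Lemma proper_prefix_ltn w v : proper_prefix w v -> size w < size v.
Proof.
case/andP=> /prefixP[s ->]; case: s => [|a s]; first by rewrite cats0 eqxx.
by rewrite size_cat /= addnS ltnS leq_addr.
Qed.

(** Minimality of the border is dropped here: what the count needs is that [u] and the length alone
    determine the first [lso u v] letters of [v]. *)
Lemma lso_overlap u v : lso u v != 0 ->
  (lso u v < size v) && (take (lso u v) v == drop (size u - lso u v) u).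
Proof.
case/lso_exists=> w /and3P[_ /andP[sw _] pw] <-.
rewrite (proper_prefix_ltn pw) /=.
case/andP: pw => + _; rewrite prefixE => /eqP ->.
by case/suffixP: sw => s ->; rewrite size_cat addnK drop_size_cat.
Qed.

(** With the first [l] letters prescribed, [drop l] is injective, and its values are words of length
    [n - l]. *)
Lemma card_tuple_take n l (w : seq A) : l <= n ->
  #|[set v : n.-tuple A | take l v == w]| <= #|A| ^ (n - l).
Proof.
move=> le_ln; rewrite -card_tuple.
have sz (v : n.-tuple A) : size (drop l v) == n - l.
  by rewrite size_drop size_tuple.
rewrite -(@card_in_imset _ _ (fun v : n.-tuple A => Tuple (sz v))) ?max_card //.
move=> v1 v2; rewrite !inE => /eqP e1 /eqP e2 /(congr1 val) /= eqd.
by apply: val_inj; rewrite /= -(cat_take_drop l v1) -(cat_take_drop l v2) e1 e2 eqd.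
Qed.

Lemma sum_lso_le n (u : n.-tuple A) :
  \sum_(v : n.-tuple A) lso u v <= \sum_(l < n) l * #|A| ^ (n - l).
Proof.
pose overlap (l : nat) (v : n.-tuple A) := take l v == drop (n - l) u.
(* A union bound: the term at [l = lso u v] alone already contributes [lso u v]. *)
apply: (@leq_trans (\sum_(v : n.-tuple A) \sum_(l < n) l * overlap l v)).
  apply: leq_sum => v _; case: (eqVneq (lso u v) 0) => [-> //|].
  case/lso_overlap/andP; rewrite !size_tuple => ltn eqt.
  by rewrite (bigD1 (Ordinal ltn)) //= /overlap eqt muln1 leq_addr.
rewrite exchange_big /=; apply: leq_sum => l _.
rewrite -big_distrr leq_mul2l; apply/orP; right.
apply: leq_trans (card_tuple_take (drop (n - l) u) (ltnW (ltn_ord l))).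
rewrite -sum1_card [in leqRHS]big_mkcond /=.
by apply: leq_sum => v _; rewrite inE /overlap; case: eqP.
Qed.

End RightBorders.

Lemma sum_arith_geom_le k n : 2 <= k ->
  \sum_(l < n) l * k ^ (n - l) <= 2 * k ^ n.
Proof.
(* The slack [2 * n + 2] makes the induction work. Passing to [n.+1] multiplies the sum by [k] and
   adds [n * k], so the step reduces to [2 * n + 4 <= k * (n + 2)], an equality at [k = 2]. *)
move=> k_ge2; suff: \sum_(l < n) l * k ^ (n - l) + (2 * n + 2) <= 2 * k ^ n.
  exact/leq_trans/leq_addr.
elim: n => [|n IHn]; first by rewrite big_ord0.
rewrite big_ord_recr /= subSnn expn1.
rewrite (eq_bigr (fun l : 'I_n => k * (l * k ^ (n - l)))) => [|l _]; last first.
  by rewrite subSn ?expnS 1?ltnW // mulnCA.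
rewrite -big_distrr /= expnS mulnCA.
have := leq_mul (leqnn k) IHn; have := leq_mul k_ge2 (leqnn n).
by move: (\sum_(l < n) _) (k ^ n) => S K {IHn}; nia.
Qed.

Lemma eq_seq_I1 (s t : seq 'I_1) : size s = size t -> s = t.
Proof.
by move=> eqs; apply: (eq_from_nth (x0 := ord0)) => // i _; rewrite !ord1.
Qed.

(** A border is non-empty and proper, so its existence forces both words to have at least two
    letters; over one letter, the word of length one is then a border too. *)
Lemma lso_I1_le1 (u v : seq 'I_1) : lso u v <= 1.
Proof.
case: (eqVneq (lso u v) 0) => [-> //|]; case/lso_exists=> w bw.
case/and3P: (bw) => w0 /andP[sw nwu] pw; move: (proper_prefix_ltn pw) => ltv.
have w_gt0 : 0 < size w by rewrite lt0n size_eq0.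
have ltu : size w < size u.
  rewrite ltn_neqAle size_suffix // andbT.
  by apply: contra nwu => /eqP /eq_seq_I1 ->.
move=> _; suff bord0 : right_border u v [:: ord0].
  by case: (lso_shortest bord0) => _ /(_ _ bord0).
apply/and3P; split=> //; apply/andP; split.
- apply/suffixP; exists (take (size u).-1 u); apply: eq_seq_I1.
  by rewrite size_cat size_takel ?leq_pred //=; lia.
- by apply: contraTneq ltu => <-; rewrite -leqNgt.
- by rewrite prefixE; apply/eqP/eq_seq_I1; rewrite size_takel //; exact: leq_ltn_trans ltv.
- by apply: contraTneq ltv => <-; rewrite -leqNgt.
Qed.

Lemma sum_lso_le2 k n (u : n.-tuple 'I_k) : 1 <= k ->
  \sum_(v : n.-tuple 'I_k) lso u v <= 2 * k ^ n.
Proof.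
case: k u => [|[|k]] // u _; last first.
  apply: leq_trans (sum_lso_le u) _.
  by rewrite card_ord sum_arith_geom_le.
apply: (@leq_trans (\sum_(v : n.-tuple 'I_1) 1)).
  by apply: leq_sum => v _; exact: lso_I1_le1.
by rewrite sum1_card card_tuple card_ord leq_pmull.
Qed.

Import Order.TTheory GRing.Theory Num.Theory.
Local Open Scope ring_scope.

Theorem theorem14 (R : realType) (k : nat) (hk : (1 <= k)%N) :
  exists C : R, forall n : nat, (1 <= n)%N -> expected_lso R k n <= C.
Proof.
exists 2 => n _; rewrite /expected_lso /uniform_prob card_tuple card_ord.
have kn_gt0 : 0 < (k ^ n)%:R :> R by rewrite ltr0n expn_gt0 hk.
under eq_bigr do rewrite -mulr_sumr -natr_sum.
rewrite -mulr_sumr -natr_sum -invfM mulrC ler_pdivrMr ?mulr_gt0 //.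
rewrite -!natrM ler_nat.
(* Summing the bound for fixed [u] over the [k ^ n] words [u] gives [2 * k ^ n * k ^ n], which the
   two uniform weights cancel to [2]. *)
apply: (@leq_trans (\sum_(u : n.-tuple 'I_k) 2 * k ^ n)%N).
  by apply: leq_sum => u _; exact: sum_lso_le2.
by rewrite sum_nat_const card_tuple card_ord mulnCA.
Qed.
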